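(* For $n\ge 8$, $n-2\le c_1(n,P_3)\le n+4$, where $P_3$ is the $3$-graph with vertex set $\{v_1,\dots,v_7\}$ and edges $\{v_1,v_2,v_3\},\{v_3,v_4,v_5\},\{v_5,v_6,v_7\}$.
   Context: For a $3$-graph $G$, $\delta_1(G)$ is the minimum number of edges containing a vertex; $G$ has an $F$-covering if every vertex lies in a copy of $F$; $c_1(n,F)$ is the maximum of $\delta_1(G)$ over $n$-vertex $3$-graphs $G$ with no $F$-covering. *)

(* Defs.v *)
From mathcomp Require Import all_boot.

Set Implicit Arguments.
Unset Strict Implicit.
Unset Printing Implicit Defensive.

(* A 3-graph on the vertex set T is given by its edge set, a family of
   3-element subsets of T. *)
Definition three_graph (T : finType) (G : {set {set T}}) : bool :=
  [forall e in G, #|e| == 3].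

Definition degree (T : finType) (G : {set {set T}}) (v : T) : nat :=
  #|[set e in G | v \in e]|.

(* Since degree G v <= #|G|, the default value #|G| is harmless as soon as
   T is nonempty. *)
Definition min_degree (T : finType) (G : {set {set T}}) : nat :=
  \big[minn/#|G|]_(v : T) degree G v.

(* Copies are not necessarily induced subgraphs: the image of an injection
   V(F) -> V(G) sending edges to edges. *)
Definition is_copy (U T : finType) (F : {set {set U}}) (G : {set {set T}})
    (f : {ffun U -> T}) : bool :=
  injectiveb f && [forall e in F, f @: e \in G].

Definition has_covering (U T : finType) (F : {set {set U}})
    (G : {set {set T}}) : bool :=
  [forall v : T, exists f : {ffun U -> T}, is_copy F G f && (v \in codom f)].

(* The maximum over an empty family is 0; the family is nonempty whenever F
   has an edge and n > 0 (take the edgeless G). *)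
Definition c1 (n : nat) (U : finType) (F : {set {set U}}) : nat :=
  \max_(G : {set {set 'I_n}} | three_graph G && ~~ has_covering F G)
    min_degree G.

(* The vertex v_(i+1) is the ordinal i. *)
Definition P3 : {set {set 'I_7}} :=
  let v (i : nat) : 'I_7 := inord i.-1 in
  [set [set v 1; v 2; v 3]; [set v 3; v 4; v 5]; [set v 5; v 6; v 7]].

(* Main.v *)
Require Import Defs.
From mathcomp Require Import all_boot.
From mathcomp Require Import zify.

Set Implicit Arguments.
Unset Strict Implicit.
Unset Printing Implicit Defensive.

(* Lower bound: in the star of all triples through a fixed vertex no two edges
   are disjoint, while the end edges of P3 are.
   Upper bound: let v lie in no copy of P3, let L be the link graph of v, and
   suppose that all degrees are at least n + 5.  If ab, cd are disjoint edges
   of L, then no edge {c, x, y} avoids v, a, b, d.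
   (1) If L has disjoint edges ab, cd, ef, this confines the edges at c to a
   pencil, four transversals {c, a|b, e|f} and at most one further edge, so c
   has degree at most n + 4.
   (2) Otherwise, as L has at least n + 5 edges, it has two disjoint edges, all
   vertices outside them are joined in L only to one end p of the first and one
   end q of the second, and p, q both have at least four outside neighbours.
   An outside neighbour w of p is then only in edges with two more vertices from
   v, p, q, so its degree is at most 3. *)

(** * Triples, degree bounds and pencils *)

Ltac split_distinct :=
  repeat match goal with
  | H : is_true (uniq (_ :: _)) |- _ => rewrite /= ?inE in H
  | H : is_true (_ && _) |- _ => case/andP: H => ? ?
  | H : is_true (~~ (_ || _)) |- _ => rewrite negb_or in H
  | H : is_true (_ \notin _) |- _ => progress rewrite ?inE in H
  end.

Ltac distinct :=
  split_distinct; rewrite /= ?inE ?negb_or ?andbT;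
  repeat (apply/andP; split); by [| rewrite eq_sym].

Lemma set3C (T : finType) (a b c : T) : [set a; b; c] = [set b; a; c].
Proof. by rewrite (setUC [set a]). Qed.

Lemma set3AC (T : finType) (a b c : T) : [set a; b; c] = [set a; c; b].
Proof. exact: setUAC. Qed.

Lemma set3P (T : finType) (e : {set T}) (c : T) :
  #|e| = 3 -> c \in e -> exists x y, uniq [:: c; x; y] /\ e = [set c; x; y].
Proof.
move=> e3 ce; have /cards2P [x [y [xy eE]]] : #|e :\ c| == 2.
  by move: e3; rewrite (cardsD1 c) ce add1n => -[->].
exists x, y; split; last by rewrite -(setD1K ce) eE setUA.
have : c \notin e :\ c by rewrite !inE eqxx.
by rewrite eE /= !inE xy andbT => ->.
Qed.

Lemma edge_uniq (T : finType) (G : {set {set T}}) (x y z : T) :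
  three_graph G -> [set x; y; z] \in G -> uniq [:: x; y; z].
Proof.
move=> /forall_inP G3 /G3 /eqP; rewrite -setUA cardsU1 cards2 /= !inE andbT.
by case: (_ || _); case: (_ == _).
Qed.

Lemma pick_notin (T : finType) (A : {set T}) (s : seq T) :
  size s < #|A| -> exists2 x, x \in A & x \notin s.
Proof.
move=> sA; have /subsetPn [x xA xs] : ~~ (A \subset s).
  apply: contraL sA => /subset_leq_card As; rewrite -leqNgt.
  exact: leq_trans As (card_size s).
by exists x.
Qed.

(** All upper bounds on degrees go through this: list a small family [C] and check that it catches
    each edge at [c], written with [c] first. *)
Lemma degree_le (T : finType) (G C : {set {set T}}) (c : T) (m : nat) :
  three_graph G -> #|C| <= m ->
  (forall x y, uniq [:: c; x; y] -> [set c; x; y] \in G ->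
     [set c; x; y] \in C) ->
  degree G c <= m.
Proof.
move=> /forall_inP G3 Cm GC; apply: leq_trans Cm; apply/subset_leq_card.
apply/subsetP => e; rewrite inE => /andP [eG ce].
have [x [y [u eE]]] := set3P (eqP (G3 e eG)) ce.
by rewrite eE; apply: GC => //; rewrite -eE.
Qed.

Lemma card_setU_le (T : finType) (A B : {set T}) (m n : nat) :
  #|A| <= m -> #|B| <= n -> #|A :|: B| <= m + n.
Proof. by move=> Am Bn; apply: leq_trans (leq_card_setU A B) (leq_add Am Bn). Qed.

Lemma card_pencil (T : finType) (a b : T) : a != b ->
  #|[set [set a; b; y] | y in ~: [set a; b]]| <= #|T| - 2.
Proof.
move=> ab; apply: leq_trans (leq_imset_card _ _) _.
by have := cardsC [set a; b]; rewrite cards2 ab; lia.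
Qed.

(** * Copies of the path through [v] *)

(* The path has edges abv, vdc, cxy; copies with v as the middle or as an end
   vertex are never needed. *)
Definition no_path_at (T : finType) (G : {set {set T}}) (v : T) : Prop :=
  forall a b c d x y, uniq [:: v; a; b; c; d; x; y] ->
  [set v; a; b] \in G -> [set v; c; d] \in G -> [set c; x; y] \in G -> False.

Lemma P3_copy (T : finType) (G : {set {set T}}) (v a b c d x y : T) :
  uniq [:: v; a; b; c; d; x; y] ->
  [set v; a; b] \in G -> [set v; c; d] \in G -> [set c; x; y] \in G ->
  [exists f : {ffun 'I_7 -> T}, is_copy P3 G f && (v \in codom f)].
Proof.
(* The vertices in path order: the shared vertices [v] and [c] become v_3 and v_5. *)
move=> u ab cd xy; pose s := [:: a; b; v; d; c; x; y].
have us : uniq s by distinct.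
pose f := [ffun i : 'I_7 => nth v s i]; apply/existsP; exists f.
have fE i : i < 7 -> f (inord i) = nth v s i by move=> i7; rewrite ffunE inordK.
apply/andP; split; last first.
  by apply/codomP; exists (inord 2); rewrite fE.
apply/andP; split.
  apply/injectiveP => i j; rewrite !ffunE => /eqP.
  by rewrite nth_uniq // => /eqP /val_inj.
apply/forall_inP => e; rewrite !inE -orbA.
by case/or3P => /eqP ->; rewrite !imsetU !imset_set1 !fE //=;
  [rewrite set3AC set3C | rewrite set3AC].
Qed.

Lemma no_path_meets (T : finType) (G : {set {set T}}) (v a b c d x y : T) :
  no_path_at G v -> uniq [:: v; a; b; c; d] ->
  [set v; a; b] \in G -> [set v; c; d] \in G ->
  uniq [:: c; x; y] -> [set c; x; y] \in G ->
  (x \in [:: v; a; b; d]) || (y \in [:: v; a; b; d]).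
Proof.
move=> nP u ab cd u' xy; apply/negPn/negP; rewrite negb_or => /andP [xn yn].
by apply: (nP a b c d x y) => //; distinct.
Qed.

(** * Three disjoint edges in the link graph *)

Definition matching3 (T : finType) (G : {set {set T}}) (v a b c d e f : T) :=
  [/\ uniq [:: v; a; b; c; d; e; f], [set v; a; b] \in G, [set v; c; d] \in G
    & [set v; e; f] \in G].

Definition transversals (T : finType) (c a b e f : T) :=
  [set [set c; s; t] | s in [set a; b], t in [set e; f]].

Lemma card_transversals (T : finType) (c a b e f : T) :
  #|transversals c a b e f| <= 4.
Proof.
rewrite /transversals curry_imset2X; apply: leq_trans (leq_imset_card _ _) _.
by rewrite cardsX !cards2; do 2 case: (_ != _).
Qed.

(** A path can start with [vab] or with [vef] before going through [vdc], so the edge at [c] has to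
    meet both [ab] and [ef]. These are disjoint, hence each takes one of [x] and [y]. *)
Lemma mem_transversals (T : finType) (G : {set {set T}}) (v a b c d e f x y : T) :
  no_path_at G v -> matching3 G v a b c d e f ->
  uniq [:: c; x; y] -> [set c; x; y] \in G ->
  v \notin [:: x; y] -> d \notin [:: x; y] ->
  [set c; x; y] \in transversals c a b e f.
Proof.
move=> nP [u ab cd ef] u' xy; rewrite !inE !negb_or => /andP [vx vy] /andP [dx dy].
have m1 : (x \in [set a; b]) || (y \in [set a; b]).
  have u1 : uniq [:: v; a; b; c; d] by distinct.
  have := no_path_meets nP u1 ab cd u' xy.
  rewrite !inE !(eq_sym _ v) !(eq_sym _ d).
  by rewrite (negbTE vx) (negbTE vy) (negbTE dx) (negbTE dy) !orbF.
have m2 : (x \in [set e; f]) || (y \in [set e; f]).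
  have u1 : uniq [:: v; e; f; c; d] by distinct.
  have := no_path_meets nP u1 ef cd u' xy.
  rewrite !inE !(eq_sym _ v) !(eq_sym _ d).
  by rewrite (negbTE vx) (negbTE vy) (negbTE dx) (negbTE dy) !orbF.
have dis z : z \in [set a; b] -> z \in [set e; f] -> False.
  rewrite !inE => /orP [] /eqP -> /orP [] /eqP E; split_distinct;
  by move/eqP: E; apply/negP.
case/orP: m1 => m1; case/orP: m2 => m2; try by case: (dis _ m1 m2).
- by apply/imset2P; exists x y.
- by apply/imset2P; exists y x => //; rewrite set3AC.
Qed.

(** For [z = a] the edges [vef], [vba], [acd] would form a path; the other cases are symmetric. *)
Lemma notin_matching (T : finType) (G : {set {set T}}) (v a b c d e f z : T) :
  no_path_at G v -> matching3 G v a b c d e f ->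
  [set c; d; z] \in G -> z \notin [:: a; b; e; f].
Proof.
move=> nP [u ab cd ef] cdz; rewrite !inE; apply/negP.
have E w : w == z -> [set w; c; d] \in G.
  by move=> /eqP ->; rewrite set3C set3AC.
case/or4P; rewrite eq_sym => /E {}E.
- by apply: (nP e f a b c d _ ef ab E); distinct.
- by apply: (nP e f b a c d _ ef _ E);
    [distinct | rewrite set3AC].
- by apply: (nP a b e f c d _ ab ef E); distinct.
- by apply: (nP a b f e c d _ ab _ E);
    [distinct | rewrite set3AC].
Qed.

Lemma degree_matching3 (T : finType) (G : {set {set T}}) (v a b c d e f : T) :
  three_graph G -> no_path_at G v -> matching3 G v a b c d e f ->
  degree G c <= #|T| + 4.
Proof.
move=> G3 nP m3; have [u ab cd ef] := m3.
have vc : c != v by distinct.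
have dc : c != d by distinct.
have T2 : 2 <= #|T|.
  (* The subtraction in [#|T| - 2] is truncated, so the final counts need this. *)
  by have := max_card [set c; v]; rewrite cards2 vc.
(* If some [cdz] avoids [v], the pencil of [cd], the edge [cvz] and four transversals suffice, in
   total at most [#|T| + 3]. If not, [cdv] is the only possible edge on [cd], so the pencil of [cv]
   and the transversals suffice. *)
have [/existsP [z /andP [zv cdz]]|no_z] :=
  boolP [exists z, (z != v) && ([set c; d; z] \in G)].
- have zn := notin_matching nP m3 cdz.
  (* Otherwise one of [vab], [vef] avoids [y], and it forms a path with [vyc] and [cdz]. *)
  have link_c y : uniq [:: c; v; y] -> [set c; v; y] \in G -> (y == d) || (y == z).
    move=> u' cvy; apply/negPn/negP => /norP [yd yz].
    have vcy : [set v; c; y] \in G by rewrite set3C.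
    have zcd := edge_uniq G3 cdz.
    have [yab|yab] := boolP (y \in [:: a; b]).
    + have yef : y \notin [:: e; f].
        by move: yab; rewrite !inE => /orP [] /eqP ->; distinct.
      by apply: (nP e f c y d z _ ef vcy cdz); distinct.
    + by apply: (nP a b c y d z _ ab vcy cdz); distinct.
  pose C := [set [set c; d; y] | y in ~: [set c; d]]
            :|: [set [set c; v; z]] :|: transversals c a b e f.
  apply: (@degree_le _ _ C) => //.
    have C1 : #|[set [set c; v; z]]| <= 1 by rewrite cards1.
    apply: leq_trans (card_setU_le (card_setU_le (card_pencil dc) C1)
      (card_transversals c a b e f)) _.
    by lia.
  have Cv y : uniq [:: c; v; y] -> [set c; v; y] \in G -> [set c; v; y] \in C.
    move=> u' cvy; rewrite !inE; case/orP: (link_c y u' cvy) => /eqP ->.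
    + apply/orP; left; apply/orP; left; apply/imsetP; exists v;
        last by rewrite set3AC.
      by rewrite !inE; distinct.
    + by rewrite eqxx orbT.
  have Cd y : uniq [:: c; d; y] -> [set c; d; y] \in C.
    move=> u'; rewrite !inE; apply/orP; left; apply/orP; left.
    by apply/imsetP; exists y => //; rewrite !inE; distinct.
  move=> x y u' xy.
  have u'' : uniq [:: c; y; x] by distinct.
  have yx : [set c; y; x] \in G by rewrite set3AC.
  case: (eqVneq x v) => [xv|xv]; first by subst x; apply: Cv.
  case: (eqVneq y v) => [yv|yv]; first by subst y; rewrite set3AC; apply: Cv.
  case: (eqVneq x d) => [xd|xd]; first by subst x; apply: Cd.
  case: (eqVneq y d) => [yd|yd]; first by subst y; rewrite set3AC; apply: Cd.
  by rewrite inE (mem_transversals nP m3) ?orbT //; distinct.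
- pose C := [set [set c; v; y] | y in ~: [set c; v]] :|: transversals c a b e f.
  apply: (@degree_le _ _ C) => //.
    apply: leq_trans (card_setU_le (card_pencil vc)
      (card_transversals c a b e f)) _.
    by lia.
  have Cv y : uniq [:: c; v; y] -> [set c; v; y] \in C.
    move=> u'; rewrite !inE; apply/orP; left.
    by apply/imsetP; exists y => //; rewrite !inE; distinct.
  have Cd y : y != v -> [set c; d; y] \in G -> [set c; d; y] \in C.
    by move=> yv cdy; case/existsP: no_z; exists y; rewrite yv.
  move=> x y u' xy.
  have u'' : uniq [:: c; y; x] by distinct.
  have yx : [set c; y; x] \in G by rewrite set3AC.
  case: (eqVneq x v) => [xv|xv]; first by subst x; apply: Cv.
  case: (eqVneq y v) => [yv|yv]; first by subst y; rewrite set3AC; apply: Cv.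
  case: (eqVneq x d) => [xd|xd]; first by subst x; apply: Cd.
  case: (eqVneq y d) => [yd|yd]; first by subst y; rewrite set3AC; apply: Cd.
  by rewrite inE (mem_transversals nP m3) ?orbT //; distinct.
Qed.

(** * Link edges leaving a maximal matching *)

(** In the applications [s] is the vertex set of a maximal matching in the link graph of [v], so
    that every link edge meets [s]. *)
Definition outer_link (T : finType) (G : {set {set T}}) (v : T) (s : seq T)
    (w : T) : {set T} :=
  [set x | (x \notin v :: s) && ([set v; w; x] \in G)].

Lemma card_outer_link (T : finType) (G : {set {set T}}) (v : T) (s : seq T)
    (w : T) :
  uniq (v :: s) -> #|outer_link G v s w| + (size s).+1 <= #|T|.
Proof.
move=> u; have <- : #|[set x in v :: s]| = (size s).+1.
  by rewrite cardsE (card_uniqP u).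
rewrite -(cardsC [set x in v :: s]) addnC leq_add2l.
apply/subset_leq_card/subsetP => x.
by rewrite in_set => /andP [xn _]; rewrite !inE in xn *.
Qed.

Lemma card_bigcup_seq (I : eqType) (T : finType) (s : seq I) (F : I -> {set T}) :
  #|\bigcup_(i <- s) F i| <= \sum_(i <- s) #|F i|.
Proof.
elim: s => [|i s IHs]; first by rewrite !big_nil cards0.
by rewrite !big_cons; apply: card_setU_le.
Qed.

(** As [s] covers the link edges, each of them is a pair inside [s] or is counted at its single end
    in [s]. *)
Lemma degree_split (T : finType) (G : {set {set T}}) (v : T) (s : seq T) :
  three_graph G -> uniq (v :: s) ->
  (forall x y, [set v; x; y] \in G -> (x \in s) || (y \in s)) ->
  degree G v <= 'C(size s, 2) + \sum_(w <- s) #|outer_link G v s w|.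
Proof.
move=> G3 u cov.
pose A := [set x in s].
pose C1 :=
  [set v |: e | e : {set T} in [set e : {set T} | e \subset A & #|e| == 2]].
pose C2 := \bigcup_(w <- s) [set [set v; w; x] | x in outer_link G v s w].
have C1le : #|C1| <= 'C(size s, 2).
  apply: leq_trans (leq_imset_card _ _) _; rewrite cards_draws /A cardsE.
  by rewrite (card_uniqP _) //; case/andP: u.
have C2le : #|C2| <= \sum_(w <- s) #|outer_link G v s w|.
  apply: leq_trans (card_bigcup_seq _ _) _.
  by apply: leq_sum => w _; apply: leq_imset_card.
apply: (degree_le G3 (card_setU_le C1le C2le)) => x y u' xy.
have [xv yv] : x != v /\ y != v by split; distinct.
have in2 w z : w \in s -> z \notin v :: s -> [set v; w; z] \in G ->
    [set v; w; z] \in C2.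
  move=> ws zs wz; rewrite /C2 (big_rem w ws) inE; apply/orP; left.
  by apply/imsetP; exists z => //; rewrite inE zs.
have [xs|xs] := boolP (x \in s); have [ys|ys] := boolP (y \in s).
- rewrite inE; apply/orP; left; apply/imsetP; exists [set x; y].
    rewrite inE subUset !sub1set !inE xs ys cards2.
    by have -> : x != y by distinct.
  by rewrite setUA.
- by rewrite inE in2 ?orbT // inE negb_or yv ys.
- by rewrite inE set3AC in2 ?orbT // 1?set3AC // inE negb_or xv xs.
- by have := cov _ _ xy; rewrite (negbTE xs) (negbTE ys).
Qed.

(** Meant for the outer neighbourhoods of the two ends of a matching edge: distinct [x] and [y] in
    them would replace that edge by two disjoint ones and enlarge the matching. *)
Lemma all_equal_card (T : finType) (A B : {set T}) :
  (forall x y, x \in A -> y \in B -> x = y) ->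
  [\/ A = set0, B = set0 | #|A| + #|B| <= 2].
Proof.
move=> AB; have [->|[x xA]] := set_0Vmem A; first by constructor 1.
have [->|[y yB]] := set_0Vmem B; first by constructor 2.
constructor 3; rewrite -[2]/(1 + 1) -{1}(cards1 y) -(cards1 x).
apply: leq_add; apply/subset_leq_card/subsetP => z zin; rewrite inE.
- by rewrite (AB z y).
- by rewrite (AB x z).
Qed.

(** The last hypothesis settles the edges containing [v] and [a]. Any other edge at [a] except [apq]
    would end a path that starts with one link edge at [p] and one at [q]. *)
Lemma degree_cover2 (T : finType) (G : {set {set T}}) (v p q a : T) (s : seq T) :
  three_graph G -> no_path_at G v -> uniq [:: v; p; q] ->
  p \in s -> q \in s ->
  4 <= #|outer_link G v s p| -> 4 <= #|outer_link G v s q| ->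
  a \in outer_link G v s p ->
  (forall y, [set v; a; y] \in G -> (y == p) || (y == q)) ->
  degree G a <= 3.
Proof.
move=> G3 nP u ps qs Np Nq; rewrite inE => /andP [as_ pa] link_a.
have far z w : z \notin v :: s -> w \in v :: s -> z != w.
  by move=> zs ws; apply: contraNneq zs => ->.
have out w z : z \in outer_link G v s w ->
    [/\ z != v, z != p, z != q & [set v; w; z] \in G].
  rewrite inE => /andP [zs wz].
  by split; rewrite ?wz // (far z) // inE ?eqxx ?ps ?qs ?orbT.
have [av ap aq _] := out p a ltac:(by rewrite inE as_ pa).
pose C := [set [set a; v; p]] :|: [set [set a; v; q]] :|: [set [set a; p; q]].
have C3 : #|C| <= 1 + 1 + 1.
  by do 2 (apply: card_setU_le; rewrite ?cards1 //).
apply: (degree_le G3 C3).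
have Cv y : [set a; v; y] \in G -> [set a; v; y] \in C.
  move=> avy; have /link_a : [set v; a; y] \in G by rewrite set3C.
  case/orP => /eqP ->; first by rewrite !inE eqxx.
  by rewrite !inE eqxx ?orbT.
have Cp y : y != v -> [set a; p; y] \in G -> [set a; p; y] \in C.
  move=> yv apy; have [->|yq] := eqVneq y q; first by rewrite !inE eqxx ?orbT.
  (* The path is [vbq], [vcp], [pay]. Since [c] must avoid [a], [y] and [b], four outer neighbours
     are required. *)
  have [b /out [bv bp bq qb] bn] := pick_notin (s := [:: a; y]) (ltnW Nq).
  have [c /out [cv cp cq pc] cn] := pick_notin (s := [:: a; y; b]) Np.
  have pay : [set p; a; y] \in G by rewrite set3C.
  have u' := edge_uniq G3 apy.
  by case: (nP q b p c a y _ qb pc pay); distinct.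
have Cq y : y != v -> [set a; q; y] \in G -> [set a; q; y] \in C.
  move=> yv aqy; have [->|yp] := eqVneq y p;
    first by rewrite set3AC !inE eqxx ?orbT.
  have [b /out [bv bp bq pb] bn] := pick_notin (s := [:: a; y]) (ltnW Np).
  have [c /out [cv cp cq qc] cn] := pick_notin (s := [:: a; y; b]) Nq.
  have qay : [set q; a; y] \in G by rewrite set3C.
  have u' := edge_uniq G3 aqy.
  by case: (nP p b q c a y _ pb qc qay); distinct.
move=> x y u' xy.
have yx : [set a; y; x] \in G by rewrite set3AC.
case: (eqVneq x v) => [xv|xv]; first by subst x; apply: Cv.
case: (eqVneq y v) => [yv|yv]; first by subst y; rewrite set3AC; apply: Cv.
case: (eqVneq x p) => [xp|xp]; first by subst x; apply: Cp.
case: (eqVneq y p) => [yp|yp]; first by subst y; rewrite set3AC; apply: Cp.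
case: (eqVneq x q) => [xq|xq]; first by subst x; apply: Cq.
case: (eqVneq y q) => [yq|yq]; first by subst y; rewrite set3AC; apply: Cq.
have [b /out [bv bp bq qb] bn] := pick_notin (s := [:: a; x; y]) Nq.
have ap' : [set v; a; p] \in G by rewrite set3AC.
by case: (nP q b a p x y _ qb ap' xy); distinct.
Qed.

(** * The upper bound *)

Lemma exists_small_degree (T : finType) (G : {set {set T}}) (v : T) :
  8 <= #|T| -> three_graph G -> no_path_at G v ->
  ~ (forall w, #|T| + 4 < degree G w).
Proof.
move=> T8 G3 nP big.
have M3 a b c d e f : ~ matching3 G v a b c d e f.
  by move=> /(degree_matching3 G3 nP); rewrite leqNgt big.
have M2 a b c d : uniq [:: v; a; b; c; d] ->
    [set v; a; b] \in G -> [set v; c; d] \in G -> False.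
  move=> u ab cd; pose s := [:: a; b; c; d]; pose N := outer_link G v s.
  have outP w x : x \in N w ->
      [/\ uniq [:: x; v; a; b; c; d] & [set v; w; x] \in G].
    by rewrite inE => /andP [xs wx]; split=> //; rewrite cons_uniq xs.
  have link_s x y : x \notin s -> [set v; x; y] \in G -> y \in s.
    move=> xs xy; apply/negPn/negP => ys; have u' := edge_uniq G3 xy.
    by apply: (M3 a b c d x y); split=> //; rewrite /s in xs ys; distinct.
  have Nab x y : x \in N a -> y \in N b -> x = y.
    move=> /outP [ux ax] /outP [uy by_]; apply/eqP/negPn/negP => xy.
    by apply: (M3 a x b y c d); split=> //; distinct.
  have Ncd x y : x \in N c -> y \in N d -> x = y.
    move=> /outP [ux cx] /outP [uy dy]; apply/eqP/negPn/negP => xy.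
    by apply: (M3 c x d y a b); split=> //; distinct.
  have Nle w : #|N w| + 5 <= #|T| by have := @card_outer_link _ G v s w u.
  (* At least [#|T| + 5] link edges exist and at most 6 lie inside [s], so at least [#|T| - 1] leave
     it. *)
  have sum_N : #|T| <= #|N a| + #|N b| + #|N c| + #|N d| + 1.
    have cov x y : [set v; x; y] \in G -> (x \in s) || (y \in s).
      by move=> xy; have [//|/link_s /(_ xy) ->] := boolP (x \in s).
    have := leq_trans (big v) (degree_split G3 u cov).
    have -> : 'C(size s, 2) = 6 by [].
    by rewrite !big_cons big_nil -/N; lia.
  (* Here [pp'] and [qq'] will be the two matching edges, with [p] and [q] the ends that carry all
     outer neighbours. *)
  have fin p p' q q' : uniq [:: v; p; q] -> s =i [:: p; p'; q; q'] ->
      N p' = set0 -> N q' = set0 -> 4 <= #|N p| -> 4 <= #|N q| -> False.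
    move=> u' sE Np' Nq' Np Nq.
    have [a' a'N _] := pick_notin (s := [::]) (ltnW (ltnW (ltnW Np))).
    suff : degree G a' <= 3 by rewrite leqNgt; have := big a'; lia.
    apply: (degree_cover2 G3 nP u' _ _ Np Nq a'N).
    - by rewrite sE !inE eqxx.
    - by rewrite sE !inE eqxx !orbT.
    move=> y ay; have := outP _ _ a'N => -[ua' _].
    have a's : a' \notin s by rewrite /s; distinct.
    have empty z : N z = set0 -> y != z.
      move=> Nz; apply/eqP => yz; have : a' \in N z.
        by move: a'N; rewrite !inE => /andP [-> _]; rewrite -yz set3AC.
      by rewrite Nz inE.
    have := link_s _ _ a's ay; rewrite sE !inE.
    by rewrite (negbTE (empty _ Np')) (negbTE (empty _ Nq')) orbF /=.
  have Na := Nle a; have Nb := Nle b; have Nc := Nle c; have Nd := Nle d.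
  have c0 w : N w = set0 -> #|N w| = 0 by move=> ->; rewrite cards0.
  (* Each outer neighbourhood has at most [#|T| - 5] elements. A matching edge contributing at most
     2 would keep the sum below [#|T| - 1]; so each edge has an end without outer neighbours, and
     the two remaining ends have at least 4 each. *)
  case: (all_equal_card Nab) => [/[dup] /c0 a0 A0|/[dup] /c0 b0 B0|ab2];
    case: (all_equal_card Ncd) => [/[dup] /c0 c0' C0|/[dup] /c0 d0 D0|cd2]; try lia.
  - by apply: (fin b a d c) => //; [distinct | | lia | lia];
      by move=> z; rewrite /s !inE; do 4 case: (z == _) => //=.
  - by apply: (fin b a c d) => //; [distinct | | lia | lia];
      by move=> z; rewrite /s !inE; do 4 case: (z == _) => //=.
  - by apply: (fin a b d c) => //; [distinct | | lia | lia];
      by move=> z; rewrite /s !inE; do 4 case: (z == _) => //=.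
  - by apply: (fin a b c d) => //; [distinct | lia | lia].
(* Now no two link edges are disjoint: around a link edge [ab] the link is a star or has at most
   three edges, so the degree of [v] is too small. *)
have /card_gt0P [e] : 0 < degree G v by apply: leq_ltn_trans (big v).
rewrite inE => /andP [eG ve].
have [a [b [u eE]]] := set3P (eqP (forall_inP G3 e eG)) ve.
rewrite {e ve}eE in eG; pose s := [:: a; b]; pose N := outer_link G v s.
have Nle w : #|N w| + 3 <= #|T| by have := @card_outer_link _ G v s w u.
have deg_v : degree G v <= 1 + (#|N a| + #|N b|).
  have := @degree_split _ G v s G3 u; rewrite /s !big_cons big_nil addn0; apply.
  move=> x y xy; apply/negPn/negP; rewrite negb_or => /andP [xs ys].
  have u' := edge_uniq G3 xy.
  by apply: (M2 a b x y) => //; distinct.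
have Nab x y : x \in N a -> y \in N b -> x = y.
  rewrite !inE => /andP [xn ax] /andP [yn by_]; apply/eqP/negPn/negP => xy.
  by apply: (M2 a x b y) => //; distinct.
have := big v; have Na := Nle a; have Nb := Nle b.
have c0 w : N w = set0 -> #|N w| = 0 by move=> ->; rewrite cards0.
by case: (all_equal_card Nab) => [/c0|/c0|]; lia.
Qed.

Lemma min_degree_le (T : finType) (G : {set {set T}}) (w : T) :
  min_degree G <= degree G w.
Proof.
rewrite /min_degree; elim: (index_enum T) (mem_index_enum w) => // x r IHr.
rewrite inE big_cons geq_min => /predU1P [->|/IHr ->]; first by rewrite leqnn.
by rewrite orbT.
Qed.

Lemma c1_P3_le (n : nat) : 8 <= n -> c1 n P3 <= n + 4.
Proof.
move=> n8; apply/bigmax_leqP => G /andP [G3]; rewrite negb_forall.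
case/existsP => v vP; rewrite leqNgt; apply/negP => big.
apply: (@exists_small_degree _ G v) => //; first by rewrite card_ord.
- move=> a b c d x y u ab cd xy; move/negP: vP; apply.
  exact: P3_copy u ab cd xy.
- move=> w; rewrite card_ord; apply: leq_trans big _.
  exact: min_degree_le.
Qed.

(** * The lower bound *)

Definition star (T : finType) (x : T) : {set {set T}} :=
  [set e : {set T} | (#|e| == 3) && (x \in e)].

Lemma star_degree (T : finType) (x v : T) :
  2 <= #|T| -> #|T| - 2 <= degree (star x) v.
Proof.
(* All triples on a pair containing both [x] and [v] are star edges at [v]; for [v = x] any second
   vertex serves. *)
move=> T2; have [w xw vw] : exists2 w, x != w & v \in [set x; w].
  have [->|vx] := eqVneq v x; last by exists v; rewrite 1?eq_sym // !inE eqxx orbT.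
  have [|w _] := @pick_notin T setT [:: x]; first by rewrite cardsT.
  by rewrite inE eq_sym => wx; exists w => //; rewrite !inE eqxx.
have <- : #|[set [set x; w; y] | y in ~: [set x; w]]| = #|T| - 2.
  rewrite card_in_imset; last first.
    move=> y z; rewrite !inE !negb_or => /andP [yx yw] _ /setP /(_ y).
    by rewrite !inE eqxx (negbTE yx) (negbTE yw) => /esym /eqP.
  by have := cardsC [set x; w]; rewrite cards2 xw; lia.
apply: subset_leq_card; apply/subsetP => e /imsetP [y].
rewrite in_setC => yn ->.
have e_star : [set x; w; y] \in star x.
  by rewrite in_set setUC cardsU1 yn cards2 xw !in_setU set11 !orbT.
by rewrite in_set e_star [_ \in _ :|: _]in_setU vw.
Qed.

Lemma star_min_degree (T : finType) (x : T) :
  2 <= #|T| -> #|T| - 2 <= min_degree (star x).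
Proof.
move=> T2; rewrite /min_degree; elim/big_ind: _ => [|m n|v _].
(* The default value of the minimum, the number of edges, is at least the degree of [x]. *)
- apply: leq_trans (star_degree x x T2) _; apply: subset_leq_card.
  by apply/subsetP => e; rewrite inE => /andP [].
- by rewrite leq_min => -> ->.
- exact: star_degree.
Qed.

Lemma star_no_covering (T : finType) (x : T) : ~~ has_covering P3 (star x).
Proof.
apply/negP => /forallP /(_ x) /existsP [f /andP [/andP [/injectiveP f_inj]]].
move=> /forall_inP P3f _.
have x_in e : e \in P3 -> x \in f @: e by move/P3f; rewrite inE => /andP [].
(* Counting from 0, the end edges of the path are 0, 1, 2 and 4, 5, 6. *)
have /imsetP [i i1 xi] : x \in f @: [set inord 0; inord 1; inord 2].
  by apply: x_in; rewrite !inE eqxx.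
have /imsetP [j j3 xj] : x \in f @: [set inord 4; inord 5; inord 6].
  by apply: x_in; rewrite !inE eqxx !orbT.
have ij : i = j by apply: f_inj; rewrite -xi.
move: i1 j3; rewrite -ij !inE -!val_eqE /= !inordK //.
by lia.
Qed.

Lemma c1_P3_ge (n : nat) : 2 <= n -> n - 2 <= c1 n P3.
Proof.
case: n => // n n2.
have := @star_min_degree _ (@ord0 n); rewrite card_ord => /(_ n2) /leq_trans; apply.
apply: (@leq_bigmax_cond _ _ _ (star ord0)).
rewrite star_no_covering andbT; apply/forall_inP => e.
by rewrite inE => /andP [].
Qed.

Theorem theorem10 (n : nat) (hn : 8 <= n) :
  n - 2 <= c1 n P3 <= n + 4.
Proof.
by rewrite c1_P3_ge ?c1_P3_le //; lia.
Qed.
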